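(* Consider a representation of the algebra $\mathrm{AW}_2$ on $V_1\otimes V_2$ as described in the context, with parameters $0<q<1$, $\alpha_0,\alpha_1,\alpha_2\in\mathbb{R}$, $N_1,N_2\in\mathbb{Z}_{\ge0}$, and with the eigenvectors $\psi_{n_2}$, $\psi_{n_1}^{n_2}$, $\phi_{m_1}$, $\phi_{m_2}^{m_1}$ defined there. For $k_1,j_1\in\{0,\dots,N_1\}$ and $k_2,j_2\in\{0,\dots,N_2\}$ put $$n_2=k_2-\tfrac12N_2,\quad n_1=k_1+n_2-\tfrac12N_1,\quad m_1=j_1-\tfrac12N_1,\quad m_2=j_2+m_1-\tfrac12N_2,$$ and $n_1(0)=n_2-\frac12N_1$, $n_2(0)=-\frac12N_2$, $m_1(0)=-\frac12N_1$, $m_2(0)=m_1-\frac12N_2$. Define $$P_{n_1,n_2}(m_1,m_2)=C\,\big\langle\phi_{m_1}\otimes\phi_{m_2}^{m_1},\psi_{n_1}^{n_2}\otimes\psi_{n_2}\big\rangle_{V_1\otimes V_2},$$ $$C=\frac{\langle\phi_{m_1(0)},\psi_{n_1(0)}^{n_2}\rangle_{V_1}\,\langle\phi_{m_2(0)}^{m_1},\psi_{n_2(0)}\rangle_{V_2}}{\langle\phi_{m_1},\psi_{n_1(0)}^{n_2}\rangle_{V_1}\,\langle\phi_{m_2}^{m_1},\psi_{n_2(0)}\rangle_{V_2}\,\langle\phi_{m_1(0)},\psi_{n_1}^{n_2}\rangle_{V_1}\,\langle\phi_{m_2(0)}^{m_1},\psi_{n_2}\rangle_{V_2}},$$ where it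 is assumed that all inner products occurring in the denominator are nonzero for all admissible indices. Then, for all $k_1,j_1\in\{0,\dots,N_1\}$ and $k_2,j_2\in\{0,\dots,N_2\}$, $$P_{n_1,n_2}(m_1,m_2)=R_{k_1}\big(y_{j_1};-q^{\alpha_0+2k_2-N_2+\alpha_1+\alpha_2-N_1-1},\,q^{\alpha_0+2k_2-N_2-\alpha_1-\alpha_2-N_1-1},\,q^{-2N_1-2},\,-q^{2\alpha_1};q^2\big)$$ $$\times R_{k_2}\big(y_{j_2};-q^{\alpha_0+\alpha_1+2j_1-N_1-\alpha_2-N_2-1},\,q^{\alpha_0-\alpha_1-2j_1+N_1+\alpha_2-N_2-1},\,q^{-2N_2-2},\,-q^{2\alpha_1+4j_1-2N_1};q^2\big),$$ where $y_{j_1}=q^{-2j_1}-q^{2\alpha_1-2N_1+2j_1}$, $y_{j_2}=q^{-2j_2}-q^{2\alpha_1-2N_1-2N_2+4j_1+2j_2}$ and $R_n$ denotes the $q$-Racah polynomial.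
   Context: Notation: $\sinh_q(x)=q^x-q^{-x}$, $\cosh_q(x)=q^x+q^{-x}$. $q$-Racah polynomials: with $y_j=q^{-j}+\gamma\delta q^{j+1}$, $$R_n(y_j;\alpha,\beta,\gamma,\delta;q)={}_4\phi_3\left[\begin{matrix}q^{-n},\alpha\beta q^{n+1},q^{-j},\gamma\delta q^{j+1}\\ \alpha q,\beta\delta q,\gamma q\end{matrix};q;q\right]=\sum_{i\ge0}\frac{(q^{-n},\alpha\beta q^{n+1},q^{-j},\gamma\delta q^{j+1};q)_i}{(\alpha q,\beta\delta q,\gamma q,q;q)_i}q^i$$ (a terminating sum, over $0\le i\le\min(n,j)$); with last argument $q^2$, every $q$ is replaced by $q^2$. AW-relations: for elements $K,L,A_0,\dots,A_5$ of a unital algebra, $\mathscr{AW}(K,L\mid A_0,\dots,A_5)=0$ means $$\cosh_q(2)KLK-K^2L-LK^2=(\sinh_q(1))^2(A_0A_1-A_2A_3)K-(\cosh_q(1))^2A_5L+\cosh_q(1)(A_1A_3A_5+(\sinh_q(1))^2A_0A_2),$$ $$\cosh_q(2)LKL-L^2K-KL^2=(\sinh_q(1))^2(A_0A_1-A_2A_3)L-(\cosh_q(1))^2A_4K+\cosh_q(1)(A_0A_3A_4+(\sinh_q(1))^2A_1A_2).$$ The structure parameters $A_0,\dots,A_5$ are locally central if they commute with each other and with $K$ and $L$. The algebra $\mathrm{AW}_2$, for real constants $A_0,A_1,A_2,A_{N_1},A_{N_2},\sigma_K,\sigma_L$: for $i=1,2$ let $\mathrm{AW}_1(A_{N_i})$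 be the unital algebra generated by $K_1,L_1$ with $\mathscr{AW}(K_1,L_1\mid A_0,A_1,A_2,A_{N_i},\sigma_L,\sigma_K)=0$; let $\mathscr{A}=\mathrm{AW}_1(A_{N_1})\otimes\mathrm{AW}_1(A_{N_2})$; let $\mathrm{AW}_1(M_2)$ be the unital algebra generated by $K_2,L_2$ and a central element $M_2$ with $\mathscr{AW}(K_2,L_2\mid A_0,A_1,A_2,M_2,\sigma_L,\sigma_K)=0$. Then $\mathrm{AW}_2$ is the unital associative complex algebra generated by $\mathscr{A}$ and $\mathrm{AW}_1(M_2)$ (free product of unital algebras) subject to $$\mathscr{AW}(1\otimes K_1,L_2\mid A_0,L_1\otimes1,A_2,A_{N_2},\sigma_L,\sigma_K)=0,\qquad \mathscr{AW}(K_2,L_1\otimes1\mid1\otimes K_1,A_1,A_2,A_{N_1},\sigma_L,\sigma_K)=0,$$ $$\mathscr{AW}(1\otimes K_1,M_2\mid A_0,A_{N_1},-K_2,A_{N_2},-(\sinh_q(1))^2,\sigma_K)=0,\qquad \mathscr{AW}(M_2,L_1\otimes1\mid A_{N_2},A_1,-L_2,A_{N_1},\sigma_L,-(\sinh_q(1))^2)=0,$$ where in each relation all structure parameters are required to be locally central. The representation: $A_0=\sinh_q(\alpha_0)$, $A_1=\sinh_q(\alpha_1)$, $A_2=\cosh_q(\alpha_2)$, $A_{N_i}=\cosh_q(N_i+1)$, $\sigma_K=\sigma_L=(\sinh_q(1))^2$. Put $\lambda_x=\sinh_q(2x+\alpha_0)$ and $\mu_x=\sinh_q(2x+\alpha_1)$.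 $V_1,V_2$ are finite-dimensional complex inner product spaces with $\dim V_i=N_i+1$, and $V_1\otimes V_2$ has the product inner product. $\mathrm{AW}_2$ acts on $V_1\otimes V_2$ so that $\mathscr{A}$ acts as the tensor product of representations of $\mathrm{AW}_1(A_{N_i})$ on $V_i$, where on $V_i$ the operator $K_1$ is diagonalizable with simple eigenvalues $\lambda_{k-N_i/2}$ ($0\le k\le N_i$) and $L_1$ is diagonalizable with simple eigenvalues $\mu_{j-N_i/2}$ ($0\le j\le N_i$); the operators $1\otimes K_1,\ L_1\otimes1,\ K_2,\ L_2,\ M_2$ are self-adjoint. Eigenvectors (all of norm one): $\psi_{n_2}\in V_2$ with $K_1\psi_{n_2}=\lambda_{n_2}\psi_{n_2}$, $n_2\in\{k-\frac12N_2:0\le k\le N_2\}$; $\phi_{m_1}\in V_1$ with $L_1\phi_{m_1}=\mu_{m_1}\phi_{m_1}$, $m_1\in\{j-\frac12N_1:0\le j\le N_1\}$; for each $n_2$, an orthonormal basis $\{\psi_{n_1}^{n_2}\}$ of $V_1$, $n_1\in\{k+n_2-\frac12N_1:0\le k\le N_1\}$, with $K_2(\psi_{n_1}^{n_2}\otimes\psi_{n_2})=\lambda_{n_1}\psi_{n_1}^{n_2}\otimes\psi_{n_2}$; for each $m_1$, an orthonormal basis $\{\phi_{m_2}^{m_1}\}$ of $V_2$, $m_2\in\{j+m_1-\frac12N_2:0\le j\le N_2\}$, with $L_2(\phi_{m_1}\otimes\phi_{m_2}^{m_1})=\mu_{m_2}\phi_{m_1}\otimes\phi_{m_2}^{m_1}$.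 *)

(* Defs.v *)
From HB Require Import structures.
From mathcomp Require Import all_boot all_order all_algebra.
From mathcomp Require Import complex.
From mathcomp Require Import reals exp.

Set Implicit Arguments.
Unset Strict Implicit.
Unset Printing Implicit Defensive.

Import Order.TTheory GRing.Theory Num.Theory.
Local Open Scope ring_scope.

Definition sinhq (R : realType) (q x : R) : R := q `^ x - q `^ (- x).
Definition coshq (R : realType) (q x : R) : R := q `^ x + q `^ (- x).

Definition qpoch (F : fieldType) (a q : F) (n : nat) : F :=
  \prod_(i < n) (1 - a * q ^+ i).

Definition qRacah_node (F : fieldType) (j : nat) (gamma delta q : F) : F :=
  q ^- j + gamma * delta * q ^+ j.+1.

(* R_n(y_j; alpha, beta, gamma, delta; q) with y_j = qRacah_node j gamma delta q;
   the polynomial enters through its values at the nodes y_j. *)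
Definition qRacah (F : fieldType) (n j : nat) (alpha beta gamma delta q : F)
    : F :=
  \sum_(i < (minn n j).+1)
    (qpoch (q ^- n) q i * qpoch (alpha * beta * q ^+ n.+1) q i
       * qpoch (q ^- j) q i * qpoch (gamma * delta * q ^+ j.+1) q i)
    / (qpoch (alpha * q) q i * qpoch (beta * delta * q) q i
       * qpoch (gamma * q) q i * qpoch q q i)
    * q ^+ i.

Section AskeyWilson.
Variables (R : realType) (q : R) (V : vectType R[i]).
Implicit Types K L M X Y A : 'End(V).

Local Notation "X ** Y" := (comp_lfun X Y) (at level 40, left associativity).

Definition rscal (c : R) : 'End(V) := c%:C%C *: \1%VF.

Definition commutes X Y : Prop := X ** Y = Y ** X.

Definition locally_central K L (As : seq 'End(V)) : Prop :=
  forall X, X \in As ->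
    [/\ commutes X K, commutes X L & forall Y, Y \in As -> commutes X Y].

Definition AW_relations K L A0 A1 A2 A3 A4 A5 : Prop :=
  let s1 := ((sinhq q 1)%:C)%C in
  let c1 := ((coshq q 1)%:C)%C in
  let c2 := ((coshq q 2)%:C)%C in
  let D := A0 ** A1 - A2 ** A3 in
  (c2 *: (K ** L ** K) - K ** K ** L - L ** K ** K
     = s1 ^+ 2 *: (D ** K) - c1 ^+ 2 *: (A5 ** L)
       + c1 *: (A1 ** A3 ** A5 + s1 ^+ 2 *: (A0 ** A2)))
  /\ (c2 *: (L ** K ** L) - L ** L ** K - K ** L ** L
     = s1 ^+ 2 *: (D ** L) - c1 ^+ 2 *: (A4 ** K)
       + c1 *: (A0 ** A3 ** A4 + s1 ^+ 2 *: (A1 ** A2))).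

Definition AW K L A0 A1 A2 A3 A4 A5 : Prop :=
  locally_central K L [:: A0; A1; A2; A3; A4; A5]
  /\ AW_relations K L A0 A1 A2 A3 A4 A5.

Definition AW1_rep (a0 a1 a2 aN sK sL : R) K L : Prop :=
  AW K L (rscal a0) (rscal a1) (rscal a2) (rscal aN) (rscal sL) (rscal sK).

(* A representation on V of AW_2, given by the images of its generators:
   K1l, L1l, K1r, L1r stand for K_1 (x) 1, L_1 (x) 1, 1 (x) K_1, 1 (x) L_1. *)
Record AW2_rep (a0 a1 a2 aN1 aN2 sK sL : R) (K1l L1l K1r L1r K2 L2 M2 : 'End(V))
    : Prop := {
  AW2_left : AW1_rep a0 a1 a2 aN1 sK sL K1l L1l;
  AW2_right : AW1_rep a0 a1 a2 aN2 sK sL K1r L1r;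
  AW2_tensor : [/\ commutes K1l K1r, commutes K1l L1r,
                   commutes L1l K1r & commutes L1l L1r];
  AW2_second : AW K2 L2
    (rscal a0) (rscal a1) (rscal a2) M2 (rscal sL) (rscal sK);
  AW2_K1L2 : AW K1r L2
    (rscal a0) L1l (rscal a2) (rscal aN2) (rscal sL) (rscal sK);
  AW2_K2L1 : AW K2 L1l
    K1r (rscal a1) (rscal a2) (rscal aN1) (rscal sL) (rscal sK);
  AW2_K1M2 : AW K1r M2
    (rscal a0) (rscal aN1) (- K2) (rscal aN2)
    (rscal (- sinhq q 1 ^+ 2)) (rscal sK);
  AW2_M2L1 : AW M2 L1l
    (rscal aN2) (rscal a1) (- L2) (rscal aN1)
    (rscal sL) (rscal (- sinhq q 1 ^+ 2))
}.

Definition diagonalizable_simple (n : nat) (T : 'End(V)) (ev : 'I_n -> R)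
    : Prop :=
  (forall k, \dim (passmx.leigenspace T ((ev k)%:C)%C) = 1%N)
  /\ (\sum_k passmx.leigenspace T ((ev k)%:C)%C)%VS = fullv.

Definition self_adjoint (f : {dot V for Num.conj}) (T : 'End(V)) : Prop :=
  forall u v, f (T u) v = f u (T v).

Definition orthonormal_basis (f : {dot V for Num.conj}) (n : nat)
    (e : 'I_n -> V) : Prop :=
  (forall i j, f (e i) (e j) = (i == j)%:R) /\ basis_of fullv (codom e).

End AskeyWilson.

Arguments rscal {R V} c.

Section Tensor.
Variables (C : fieldType) (V1 V2 W : vectType C).

Definition is_tensor_product (t : {bilinear V1 -> V2 -> W}) : Prop :=
  forall (U : vectType C) (b : {bilinear V1 -> V2 -> U}),
    exists! f : 'Hom(W, U), forall v w, f (t v w) = b v w.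

Definition is_tensor_operator (t : {bilinear V1 -> V2 -> W})
    (f : 'End(V1)) (g : 'End(V2)) (T : 'End(W)) : Prop :=
  forall v w, T (t v w) = t (f v) (g w).

End Tensor.

Section Overlap.
Variables (R : realType) (V1 V2 W : vectType R[i]).
Variables (f1 : {dot V1 for Num.conj}) (f2 : {dot V2 for Num.conj}).
Variables (f : {dot W for Num.conj}) (t : {bilinear V1 -> V2 -> W}).
Variables (N1 N2 : nat).
Variables (psi2 : 'I_N2.+1 -> V2) (psi1 : 'I_N2.+1 -> 'I_N1.+1 -> V1).
Variables (phi1 : 'I_N1.+1 -> V1) (phi2 : 'I_N1.+1 -> 'I_N2.+1 -> V2).

(* The vectors are indexed by k_1, k_2, j_1, j_2 instead of the half-integers
   n_1, n_2, m_1, m_2; the starting points n_i(0), m_i(0) have index ord0. *)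
Definition overlap_const (k1 j1 : 'I_N1.+1) (k2 j2 : 'I_N2.+1) : R[i] :=
  (f1 (phi1 ord0) (psi1 k2 ord0) * f2 (phi2 j1 ord0) (psi2 ord0))
  / (f1 (phi1 j1) (psi1 k2 ord0) * f2 (phi2 j1 j2) (psi2 ord0)
     * f1 (phi1 ord0) (psi1 k2 k1) * f2 (phi2 j1 ord0) (psi2 k2)).

Definition overlapP (k1 j1 : 'I_N1.+1) (k2 j2 : 'I_N2.+1) : R[i] :=
  overlap_const k1 j1 k2 j2
  * f (t (phi1 j1) (phi2 j1 j2)) (t (psi1 k2 k1) (psi2 k2)).

End Overlap.

(* Main.v *)
Require Import Defs.
From HB Require Import structures.
From mathcomp Require Import all_boot all_order all_algebra.
From mathcomp Require Import complex.
From mathcomp Require Import reals exp.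
From mathcomp Require Import ring.

(** The inner product on [V1 (x) V2] splits the overlap into a factor on [V1]
    (with [k2] fixed) and one on [V2] (with [j1] fixed); each comes from a pair
    [K], [L] satisfying the AW-relations with scalar structure parameters.

    For such a pair, with eigenvectors [e k] of [K], [f j] of [L] and
    [g j k = <f j, e k>], the first relation makes [L] tridiagonal in the basis
    [e] and fixes its diagonal; the second one does the same for [K] in the
    basis [f].  So the normalized overlap [G j k = g 0 0 g j k / (g j 0 g 0 k)]
    satisfies a three-term recurrence in [k].  The off-diagonal coefficients
    need not be computed from the algebra: [G 0 k = 1] and the explicit
    [G 1 k = (lam k - K00) / (lam 0 - K00)] (from the row [j = 0] of [K])
    determine them, and they turn out to be those of the q-Racah recurrence.
    As [G j 0 = 1], the recurrence forces [G j k] to be the q-Racah value.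

    The q-Racah recurrence itself holds because the difference operator is
    bidiagonal on the products [(p^-k, a b p^(k+1); p)_i]. *)

Set Implicit Arguments.
Unset Strict Implicit.
Unset Printing Implicit Defensive.

Import Order.TTheory GRing.Theory Num.Theory.
Local Open Scope ring_scope.

(** * The q-Pochhammer symbol *)

Section QPochhammer.
Variable F : fieldType.
Implicit Types a p : F.

Lemma qpoch0 a p : qpoch a p 0 = 1.
Proof. by rewrite /qpoch big_ord0. Qed.

Lemma qpochSr a p n : qpoch a p n.+1 = qpoch a p n * (1 - a * p ^+ n).
Proof. by rewrite /qpoch big_ord_recr. Qed.

Lemma qpochSl a p n : qpoch a p n.+1 = (1 - a) * qpoch (a * p) p n.
Proof.
rewrite /qpoch big_ord_recl expr0 mulr1; congr (_ * _).
by apply: eq_bigr => i _; rewrite lift0 exprS mulrA.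
Qed.

Lemma qpoch_vanish p n i : p != 0 -> (n < i)%N -> qpoch (p ^- n) p i = 0.
Proof.
move=> p0 ni; rewrite /qpoch (bigD1 (Ordinal ni)) //=.
by rewrite mulVf ?expf_neq0// subrr mul0r.
Qed.

End QPochhammer.

(** * The recurrence of the q-Racah polynomials in the degree *)

Section QRacahRecurrence.
Variables (F : fieldType) (a b c d p : F).

(* The coefficients of [R_(n+1)] and [R_(n-1)] in the q-Racah recurrence, as
   functions of [t = p ^+ n]. *)
Definition qRacah_A (t : F) :=
  (1 - a * p * t) * (1 - a * b * p * t) * (1 - b * d * p * t)
    * (1 - c * p * t)
  / ((1 - a * b * p * t ^+ 2) * (1 - a * b * p ^+ 2 * t ^+ 2)).

Definition qRacah_C (t : F) :=
  p * (1 - t) * (1 - b * t) * (c - a * b * t) * (d - a * t)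
  / ((1 - a * b * t ^+ 2) * (1 - a * b * p * t ^+ 2)).

(** The summand is split into a part free of the degree and, in [qRacah_basis], a part that sees the
    degree only through [t = p ^+ n]. Raising or lowering the degree then means replacing [t] by
    [p * t] or [t / p]. *)
Definition qRacah_coef (j i : nat) :=
  qpoch (p ^- j) p i * qpoch (c * d * p ^+ j.+1) p i
  / (qpoch (a * p) p i * qpoch (b * d * p) p i * qpoch (c * p) p i
     * qpoch p p i) * p ^+ i.

Definition qRacah_basis (i : nat) (t : F) :=
  qpoch t^-1 p i * qpoch (a * b * p * t) p i.

Definition qRacah_fun (j : nat) (t : F) :=
  \sum_(i < j.+1) qRacah_coef j i * qRacah_basis i t.

(** This is [y_j - y_0] for the nodes [y_j = p^-j + c d p^(j+1)]. *)
Definition qRacah_eps (j : nat) := - (1 - p ^- j) * (1 - c * d * p ^+ j.+1).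

Definition qRacah_eta (i : nat) :=
  - p ^- i * (1 - a * p ^+ i) * (1 - b * d * p ^+ i) * (1 - c * p ^+ i)
  * (1 - p ^+ i).

Hypothesis p0 : p != 0.

(** The factor [(p^-n; p)_i] kills the terms with [n < i <= j], so the range of summation can be
    made independent of the degree. *)
Lemma qRacah_funE n j : qRacah n j a b c d p = qRacah_fun j (p ^+ n).
Proof.
rewrite /qRacah /qRacah_fun.
have le1 : ((minn n j).+1 <= j.+1)%N by rewrite ltnS geq_minr.
rewrite (big_ord_widen j.+1 (fun i : nat =>
    (qpoch (p ^- n) p i * qpoch (a * b * p ^+ n.+1) p i
       * qpoch (p ^- j) p i * qpoch (c * d * p ^+ j.+1) p i)
    / (qpoch (a * p) p i * qpoch (b * d * p) p i
       * qpoch (c * p) p i * qpoch p p i)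
    * p ^+ i)) //.
rewrite big_mkcond; apply: eq_bigr => i _.
rewrite /qRacah_coef /qRacah_basis -(mulrA (a * b)) -exprS.
case: ifPn => [_|]; first by ring.
rewrite -leqNgt gtn_min => /orP[ni|]; last by rewrite ltnNge -ltnS ltn_ord.
by rewrite (qpoch_vanish p0 ni) mul0r mulr0.
Qed.

Section Step.
Variable t : F.
Hypotheses (t0 : t != 0).
Hypotheses (h0 : 1 - a * b * t ^+ 2 != 0) (h1 : 1 - a * b * p * t ^+ 2 != 0).
Hypotheses (h2 : 1 - a * b * p ^+ 2 * t ^+ 2 != 0).

Lemma qRacah_basis_rec (i : nat) :
  (forall m, 1 - a * b * t * p ^+ m != 0) ->
  qRacah_A t * (qRacah_basis i.+1 (p * t) - qRacah_basis i.+1 t)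
  + qRacah_C t * (qRacah_basis i.+1 (t / p) - qRacah_basis i.+1 t)
  = qRacah_eps i.+1 * qRacah_basis i.+1 t
    + qRacah_eta i.+1 * qRacah_basis i t.
Proof.
move=> hab; rewrite /qRacah_basis.
(* All six q-Pochhammer symbols are reduced to [P] and [S]; what remains is a rational identity in
   which [p ^+ i] is a free variable. *)
set P := qpoch t^-1 p i; set S := qpoch (a * b * p * t) p i.
have hx := hab 1%N; rewrite expr1 in hx.
have e1 : qpoch (p * t)^-1 p i.+1 = (1 - (p * t)^-1) * P.
  by rewrite qpochSl invfM mulrAC mulVf// mul1r.
have e2 : qpoch (a * b * p * (p * t)) p i.+1
    = S * (1 - a * b * p * t * p ^+ i) * (1 - a * b * p * t * p ^+ i.+1)
      / (1 - a * b * t * p).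
  rewrite -!qpochSr [in RHS]qpochSl.
  have -> : a * b * p * (p * t) = a * b * p * t * p by ring.
  by field.
have e3 : qpoch t^-1 p i.+1 = P * (1 - t^-1 * p ^+ i) by rewrite qpochSr.
have e4 : qpoch (a * b * p * t) p i.+1 = S * (1 - a * b * p * t * p ^+ i).
  by rewrite qpochSr.
(* The value [t = 1] (degree 0) is allowed, so [1 - t] is not divided out; it is borrowed from the
   numerator of [qRacah_C] instead. *)
have e5 : (1 - t) * qpoch (t / p)^-1 p i.+1
   = - t * (P * (1 - t^-1 * p ^+ i) * (1 - t^-1 * p ^+ i.+1)).
  by rewrite -!qpochSr [in RHS]qpochSl invf_div [p / t]mulrC; field.
have e6 : qpoch (a * b * p * (t / p)) p i.+1 = (1 - a * b * t) * S.
  have -> : a * b * p * (t / p) = a * b * t by field.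
  by rewrite qpochSl /S; congr (_ * qpoch _ _ _); ring.
have -> : qRacah_C t
    * (qpoch (t / p)^-1 p i.+1 * qpoch (a * b * p * (t / p)) p i.+1
     - qpoch t^-1 p i.+1 * qpoch (a * b * p * t) p i.+1) =
   p * (1 - b * t) * (c - a * b * t) * (d - a * t)
  / ((1 - a * b * t ^+ 2) * (1 - a * b * p * t ^+ 2)) *
   (((1 - t) * qpoch (t / p)^-1 p i.+1) * qpoch (a * b * p * (t / p)) p i.+1
   - (1 - t) * (qpoch t^-1 p i.+1 * qpoch (a * b * p * t) p i.+1)).
  by rewrite /qRacah_C; field; rewrite h0 h1.
rewrite e1 e2 e3 e4 e5 e6 /qRacah_A /qRacah_eps /qRacah_eta !exprS.
have := expf_neq0 i p0.
clear e1 e2 e3 e4 e5 e6.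
move: (p ^+ i) P S hx h0 h1 h2 => s P S hx k0 k1 k2 s0.
by field; rewrite k0 k1 k2 hx s0 p0 t0.
Qed.

(** Both sides carry the two new Pochhammer factors of index [i], because [eps_j - eps_i = - p^-i (1
    - p^(i-j)) (1 - c d p^(i+j+1))]. *)
Lemma qRacah_coef_step (j i : nat) :
  1 - a * p ^+ i.+1 != 0 -> 1 - b * d * p ^+ i.+1 != 0 ->
  1 - c * p ^+ i.+1 != 0 -> 1 - p ^+ i.+1 != 0 ->
  qRacah_coef j i.+1 * qRacah_eta i.+1
  = (qRacah_eps j - qRacah_eps i) * qRacah_coef j i.
Proof.
move=> ha hb hc hp.
rewrite /qRacah_coef /qRacah_eta /qRacah_eps !qpochSr !invfM.
have -> : a * p * p ^+ i = a * p ^+ i.+1 by rewrite exprS mulrA.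
have -> : b * d * p * p ^+ i = b * d * p ^+ i.+1 by rewrite exprS mulrA.
have -> : c * p * p ^+ i = c * p ^+ i.+1 by rewrite exprS mulrA.
rewrite -[p * p ^+ i]exprS.
move: (qpoch _ _ _)^-1 (qpoch _ _ _)^-1 (qpoch _ _ _)^-1 (qpoch _ _ _)^-1.
move: (qpoch _ _ _) (qpoch _ _ _) => u1 u2 u3 u4 u5 u6.
have := expf_neq0 i p0; have := expf_neq0 j p0.
move: ha hb hc hp; rewrite !exprS.
move: (p ^+ i) (p ^+ j) => s r ha hb hc hp r0 s0.
by field; rewrite ha hb hc hp s0 r0 p0.
Qed.

(** The diagonal entries contribute [eps_i]; the lower ones, shifted by one index, contribute
    [eps_j - eps_i]. Hence every basis function with [i < j] gets the factor [eps_j], and [i = j]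
    has it from the diagonal alone. *)
Lemma qRacah_fun_rec (j : nat) :
  (forall m, 1 - a * b * t * p ^+ m != 0) ->
  (forall i, (i < j)%N -> [/\ 1 - a * p ^+ i.+1 != 0,
     1 - b * d * p ^+ i.+1 != 0, 1 - c * p ^+ i.+1 != 0
     & 1 - p ^+ i.+1 != 0]) ->
  qRacah_A t * (qRacah_fun j (p * t) - qRacah_fun j t)
  + qRacah_C t * (qRacah_fun j (t / p) - qRacah_fun j t)
  = qRacah_eps j * qRacah_fun j t.
Proof.
move=> hab hden; rewrite /qRacah_fun -!sumrB !mulr_sumr -big_split/=.
transitivity (\sum_(i < j.+1) (qRacah_coef j i * qRacah_eps i * qRacah_basis i t
  + (if (i : nat) is i'.+1 then
      qRacah_coef j i'.+1 * qRacah_eta i'.+1 * qRacah_basis i' t else 0))).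
  (* The term of index 0 has no lower neighbour: its basis function is the constant 1 and
     [eps_0 = 0]. *)
  apply: eq_bigr => -[[|i] /= _] _.
    rewrite /qRacah_basis !qpoch0 /qRacah_eps expr0 invr1.
    rewrite !(subrr, mul0r, mulr0).
    by rewrite oppr0 !(mul0r, mulr0, addr0).
  rewrite -!mulrBr !(mulrCA _ (qRacah_coef _ _)) -mulrDr qRacah_basis_rec//.
  by rewrite mulrDr !mulrA.
rewrite big_split/= [X in _ + X = _]big_ord_recl/= add0r big_ord_recr/=.
rewrite addrAC -big_split/= [in RHS]big_ord_recr/=; congr (_ + _); last by ring.
apply: eq_bigr => i _; have [ha hb hc hp] := hden i (ltn_ord i).
by rewrite qRacah_coef_step//; ring.
Qed.

End Step.

Lemma qRacah_fun1 j : qRacah_fun j 1 = 1.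
Proof.
rewrite /qRacah_fun big_ord_recl big1 ?addr0 => [|i _].
  by rewrite /qRacah_coef /qRacah_basis !qpoch0 expr0 !mulr1 divr1.
by rewrite /qRacah_basis lift0 qpochSl invr1 subrr !mul0r mulr0.
Qed.

End QRacahRecurrence.

Ltac positivity :=
  repeat first
    [ assumption | apply: ltr01 | apply: addr_gt0 | apply: mulr_gt0
    | apply: exprn_gt0 | rewrite invr_gt0 | rewrite !mulNr opprK ].
Ltac nonzero :=
  solve [do ?[apply/andP; split]; apply: lt0r_neq0; positivity].

(** This is [sinh_q] in the multiplicative variable [u = q^x]; it makes the spectral identities
    rational. *)
Definition qsinh (F : fieldType) (u : F) : F := u - u^-1.

(** * The q-Racah coefficients in terms of the AW structure parameters *)

Section Coefficients.
Variables (F : numFieldType) (q x y z Q : F).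
Hypotheses (q_gt0 : 0 < q) (x_gt0 : 0 < x) (y_gt0 : 0 < y) (z_gt0 : 0 < z).
Hypotheses (Q_gt0 : 0 < Q).

Let a := - (x * y * z / (Q * q)).
Let b := x / (y * z * Q * q).
Let c := (Q * q) ^- 2.
Let d := - y ^+ 2.
Let p := q ^+ 2.

(** The diagonal matrix element that an AW-relation forces at the eigenvalue [qsinh u], after the
    common factor [s1 ^+ 2] is cancelled. *)
Definition AW_diag (u A0 A1 A2 A3 c1 : F) :=
  ((A0 * A1 - A2 * A3) * qsinh u + c1 * (A1 * A3 + A0 * A2))
  / ((u * q + (u * q)^-1) * (u / q + q / u)).

Let A0 := x - x^-1.
Let A1 := y - y^-1.
Let A2 := z + z^-1.
Let A3 := Q * q + (Q * q)^-1.
Let c1 := q + q^-1.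
Let lam t := qsinh (t * x / Q).
Let mu t := qsinh (t * y / Q).
Let B t := - (Q / y) * qRacah_A a b c d p t.
Let D t := - (Q / y) * qRacah_C a b c d p t.

(** Here [x], [y], [z], [Q] stand for [q] to the powers [al0], [al1], [al2], [N]. The identity is
    the recurrence in the row [j = 0], where the normalized overlap is constant. *)
Lemma AW_coef_sum t : 0 < t ->
  B t + D t = mu 1 - AW_diag (t * x / Q) A0 A1 A2 A3 c1.
Proof.
move=> t_gt0; rewrite /B /D /mu /AW_diag /qsinh /qRacah_A /qRacah_C.
rewrite /a /b /c /d /p /A0 /A1 /A2 /A3 /c1.
by field; nonzero.
Qed.

(** The recurrence in the row [j = 1], where the normalized overlap is proportional to [lam t] minus
    the diagonal entry of [K] at [f 0]. *)
Lemma AW_coef_lambda t : 0 < t ->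
  B t * (lam (p * t) - lam t) + D t * (lam (t / p) - lam t)
  = (mu p - mu 1) * (lam t - AW_diag (1 * y / Q) A1 A0 A2 A3 c1).
Proof.
move=> t_gt0; rewrite /B /D /lam /mu /AW_diag /qsinh /qRacah_A /qRacah_C.
rewrite /a /b /c /d /p /A0 /A1 /A2 /A3 /c1.
by field; nonzero.
Qed.

Lemma qRacah_eps_mu j : mu (p ^+ j) - mu 1 = - (Q / y) * qRacah_eps c d p j.
Proof.
rewrite /mu /qsinh /qRacah_eps [p ^+ j.+1]exprS /c /d /p.
have : 0 < (q ^+ 2) ^+ j by positivity.
by move: ((q ^+ 2) ^+ j) => s s_gt0; field; nonzero.
Qed.

(* The linear system is nonsingular because [lam (p t) != lam (t / p)]. *)
Lemma AW_coef_unique t u v : 0 < t -> q ^+ 4 != 1 ->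
  u + v = mu 1 - AW_diag (t * x / Q) A0 A1 A2 A3 c1 ->
  u * (lam (p * t) - lam t) + v * (lam (t / p) - lam t)
  = (mu p - mu 1) * (lam t - AW_diag (1 * y / Q) A1 A0 A2 A3 c1) ->
  u = B t /\ v = D t.
Proof.
move=> t_gt0 q4; rewrite -AW_coef_sum// -AW_coef_lambda// => e1 e2.
have ev : v = B t + D t - u by rewrite -e1 addrC addKr.
suff eu : u = B t by split=> //; rewrite ev eu addrC addKr.
have lam_ne : lam (p * t) - lam (t / p) != 0.
  have -> : lam (p * t) - lam (t / p)
      = (q ^+ 4 - 1) * (t * x / (Q * q ^+ 2) * (1 + (Q / (t * x)) ^+ 2)).
    by rewrite /lam /qsinh /p; field; nonzero.
  by rewrite mulf_neq0 ?subr_eq0//; nonzero.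
apply/eqP; rewrite -subr_eq0 -(mulIr_eq0 _ (mulIf lam_ne)).
apply/eqP; move: e2; rewrite ev => /eqP; rewrite -subr_eq0 => /eqP e2.
by rewrite -[RHS]e2; ring.
Qed.

End Coefficients.

(** * Factorization of the quadratic form in two eigenvalues *)

Section Offdiagonal.
Variable F : numFieldType.

Lemma qsinhB (u v : F) : u != 0 -> v != 0 ->
  qsinh u - qsinh v = (u - v) * (1 + (u * v)^-1).
Proof. by move=> u0 v0; rewrite /qsinh; field; rewrite u0 v0. Qed.

(** For positive arguments this can vanish only if [v = q ^+ 2 * u] or [u = q ^+ 2 * v], that is, at
    neighbouring eigenvalues; this is the source of tridiagonality. *)
Lemma AW_offdiag (q u v : F) : 0 < q -> 0 < u -> 0 < v ->
  (q ^+ 2 + q ^- 2) * qsinh u * qsinh v - qsinh u ^+ 2 - qsinh v ^+ 2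
    + (q + q^-1) ^+ 2 * (q - q^-1) ^+ 2
  = - (v - q ^+ 2 * u) * (v * q ^+ 2 - u)
    * ((1 + (v * (q ^+ 2 * u))^-1) * (1 + (v * (u / q ^+ 2))^-1)) / q ^+ 2.
Proof. by move=> *; rewrite /qsinh; field; nonzero. Qed.

Lemma AW_ondiag (q u : F) : 0 < q -> 0 < u ->
  (q ^+ 2 + q ^- 2) * qsinh u * qsinh u - qsinh u ^+ 2 - qsinh u ^+ 2
    + (q + q^-1) ^+ 2 * (q - q^-1) ^+ 2
  = (q - q^-1) ^+ 2 * ((u * q + (u * q)^-1) * (u / q + q / u)).
Proof. by move=> *; rewrite /qsinh; field; nonzero. Qed.

End Offdiagonal.

(** The lower term is guarded because [0.-1 = 0] would count [h 0] twice. *)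
Lemma sum_tridiag (F : nmodType) (h : nat -> F) n k : (k < n)%N ->
  (forall i, (i <= n)%N -> i != k.-1 -> i != k -> i != k.+1 -> h i = 0) ->
  \sum_(i < n.+1) h i = (if (0 < k)%N then h k.-1 else 0) + h k + h k.+1.
Proof.
move=> kn h0; rewrite -(big_mkord predT).
rewrite (big_cat_nat (n := k.+2)) //= [X in _ + X]big_nat.
rewrite [X in _ + X]big1 ?addr0; last first.
  move=> i /andP[ki iN]; apply: h0 => //.
  - by rewrite neq_ltn (leq_ltn_trans (leq_pred k)) ?orbT// ltnW.
  - by rewrite neq_ltn orbC ltnW.
  - by rewrite neq_ltn orbC ki.
rewrite big_nat_recr//= big_nat_recr//=; congr (_ + _ + _).
case: k kn h0 => [|k] kn h0 /=; first by rewrite big_geq.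
rewrite big_nat_recr//= big_nat big1 ?add0r// => i /andP[_ ik].
apply: h0; rewrite ?neq_ltn ?ik //.
- by rewrite (leq_trans (ltnW ik))// ltnW// ltnW.
- by rewrite ltnS ltnW.
- by rewrite ltnS ltnW// ltnW.
Qed.

(** * Overlaps of a pair with scalar structure parameters *)

Section ScalarOverlap.
Variables (F : numFieldType) (q x y z : F) (N : nat).
Hypotheses (q_gt0 : 0 < q) (q_lt1 : q < 1).
Hypotheses (x_gt0 : 0 < x) (y_gt0 : 0 < y) (z_gt0 : 0 < z).

Let Q := q ^+ N.
Let p := q ^+ 2.
Let a := - (x * y * z / (Q * q)).
Let b := x / (y * z * Q * q).
Let c := (Q * q) ^- 2.
Let d := - y ^+ 2.
Let A0 := x - x^-1.
Let A1 := y - y^-1.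
Let A2 := z + z^-1.
Let A3 := Q * q + (Q * q)^-1.
Let c1 := q + q^-1.
Let c2 := q ^+ 2 + q ^- 2.
Let s1 := q - q^-1.
Let lam (k : nat) := qsinh (p ^+ k * x / Q).
Let mu (j : nat) := qsinh (p ^+ j * y / Q).

(** [g j k] models [<f j, e k>], [L k i] models [<L (e i), e k>], and [K0 i] models
    [<K (f 0), f i>]. [LE] and [K0E] are the AW-relations read as conditions on matrix elements. *)
Variables (g L : nat -> nat -> F) (K0 : nat -> F).
Hypothesis gL : forall j k, (j <= N)%N -> (k <= N)%N ->
  mu j * g j k = \sum_(i < N.+1) L k i * g j i.
Hypothesis LE : forall k i, (k <= N)%N -> (i <= N)%N ->
  (c2 * lam k * lam i - lam k ^+ 2 - lam i ^+ 2 + c1 ^+ 2 * s1 ^+ 2) * L k i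
  = (k == i)%:R * (s1 ^+ 2 * ((A0 * A1 - A2 * A3) * lam k
                    + c1 * (A1 * A3 + A0 * A2))).
Hypothesis gK0 : forall k, (k <= N)%N ->
  lam k * g 0 k = \sum_(i < N.+1) K0 i * g i k.
Hypothesis K0E : forall i, (i <= N)%N ->
  (c2 * mu 0 * mu i - mu 0 ^+ 2 - mu i ^+ 2 + c1 ^+ 2 * s1 ^+ 2) * K0 i
  = (0%N == i)%:R * (s1 ^+ 2 * ((A1 * A0 - A2 * A3) * mu 0
                    + c1 * (A0 * A3 + A1 * A2))).
Hypothesis g_row0 : forall k, (k <= N)%N -> g 0 k != 0.
Hypothesis g_col0 : forall j, (j <= N)%N -> g j 0 != 0.

Let Q_gt0 : 0 < Q. Proof. exact: exprn_gt0. Qed.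
Let p_gt0 : 0 < p. Proof. exact: exprn_gt0. Qed.
Let p_lt1 : p < 1. Proof. by rewrite exprn_ilt1 ?ltW. Qed.

Let expp_inj : injective (fun k => p ^+ k).
Proof.
move=> k i /eqP; rewrite eq_le !ler_iXn2l ?lt0r_neq0 ?ltW //.
by rewrite -eqn_leq => /eqP.
Qed.

Let s1_neq0 : s1 != 0.
Proof.
rewrite subr_eq0; apply/eqP => qV; have := q_lt1.
have : 1 < q by rewrite qV invf_gt1.
by move=> /lt_trans h /h; rewrite ltxx.
Qed.

(** The two factors of [AW_offdiag] that could vanish are multiples of [p^i - p^(k+1)] and
    [p^(i+1) - p^k], and distinct powers of [p] differ. *)
Let offdiag_neq0 (w : F) (k i : nat) : 0 < w ->
  i != k.-1 -> i != k.+1 ->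
  c2 * qsinh (p ^+ k * w / Q) * qsinh (p ^+ i * w / Q)
    - qsinh (p ^+ k * w / Q) ^+ 2 - qsinh (p ^+ i * w / Q) ^+ 2
    + c1 ^+ 2 * s1 ^+ 2 != 0.
Proof.
move=> w_gt0 ik1 ik2.
have pk := exprn_gt0 k p_gt0; have pi := exprn_gt0 i p_gt0.
rewrite AW_offdiag//; try positivity.
have -> : p ^+ i * w / Q - q ^+ 2 * (p ^+ k * w / Q)
   = (p ^+ i - p ^+ k.+1) * (w / Q) by rewrite [p ^+ k.+1]exprS /p; ring.
have -> : p ^+ i * w / Q * q ^+ 2 - p ^+ k * w / Q
   = (p ^+ i.+1 - p ^+ k) * (w / Q) by rewrite [p ^+ i.+1]exprS /p; ring.
have hA : p ^+ i - p ^+ k.+1 != 0.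
  by rewrite subr_eq0; apply: contra ik2 => /eqP /expp_inj ->.
have hB : p ^+ i.+1 - p ^+ k != 0.
  by rewrite subr_eq0; apply: contra ik1 => /eqP /expp_inj <-.
have hw : w / Q != 0 by nonzero.
apply: mulf_neq0; last nonzero.
apply: mulf_neq0; last nonzero.
by rewrite mulNr oppr_eq0 mulf_neq0 // mulf_neq0.
Qed.

Let L_diag k : (k <= N)%N -> L k k = AW_diag q (p ^+ k * x / Q) A0 A1 A2 A3 c1.
Proof.
move=> kN; have pk := exprn_gt0 k p_gt0.
have := LE kN kN; rewrite eqxx mul1r [X in X * _]AW_ondiag//; last positivity.
rewrite -mulrA => /(mulfI (expf_neq0 2 s1_neq0)) e.
by rewrite /AW_diag -e mulrC mulKf//; nonzero.
Qed.

Let K0_diag : K0 0 = AW_diag q (1 * y / Q) A1 A0 A2 A3 c1.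
Proof.
have := K0E (leq0n N); rewrite eqxx [true%:R * _]mul1r.
rewrite [X in X * _]AW_ondiag//; last positivity.
rewrite -mulrA => /(mulfI (expf_neq0 2 s1_neq0)) e.
by rewrite /AW_diag -(expr0 p) -e mulrC mulKf//; nonzero.
Qed.

Let L_rec j k : (j <= N)%N -> (k < N)%N ->
  mu j * g j k = (if (0 < k)%N then L k k.-1 * g j k.-1 else 0)
    + L k k * g j k + L k k.+1 * g j k.+1.
Proof.
move=> jN kN; rewrite gL ?(ltnW kN)//.
rewrite (sum_tridiag (h := fun i => L k i * g j i) kN)// => i iN ik1 ik ik2.
have /eqP := LE (ltnW kN) iN; rewrite eq_sym in ik.
rewrite (negbTE ik) mul0r mulf_eq0 (negbTE (offdiag_neq0 _ _ _))//=.
by move=> /eqP ->; rewrite mul0r.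
Qed.

Let K0_rec k : (0 < N)%N -> (k <= N)%N ->
  lam k * g 0 k = K0 0 * g 0 k + K0 1 * g 1 k.
Proof.
move=> N0 kN; rewrite gK0//.
rewrite (sum_tridiag (h := fun i => K0 i * g i k) N0) ?add0r//=.
move=> i iN ik _ ik2.
have /eqP := K0E iN; rewrite eq_sym in ik.
rewrite (negbTE ik) mul0r mulf_eq0 (negbTE (offdiag_neq0 _ _ _))//=; last first.
  by rewrite eq_sym.
by move=> /eqP ->; rewrite mul0r.
Qed.

Let G j k := g 0 0 * g j k / (g j 0 * g 0 k).
(** The off-diagonal entries of [L], conjugated by the row [g 0]; the factor [g j 0] in [G] does not
    depend on [k] and leaves the recurrence unchanged. *)
Let bk k := L k k.+1 * g 0 k.+1 / g 0 k.
Let dk k := if (0 < k)%N then L k k.-1 * g 0 k.-1 / g 0 k else 0.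

Let G_rec j k : (j <= N)%N -> (k < N)%N ->
  mu j * G j k = dk k * G j k.-1 + L k k * G j k + bk k * G j k.+1.
Proof.
move=> jN kN; have := L_rec jN kN; rewrite /G /bk /dk.
have := g_col0 jN; have := g_row0 (ltnW kN); have := g_row0 kN.
have : g 0 k.-1 != 0 by apply: g_row0; rewrite (leq_trans (leq_pred k))// ltnW.
move=> h1 h2 h3 h4 e.
transitivity (mu j * g j k * (g 0 0 / (g j 0 * g 0 k))); first by ring.
rewrite e; case: ifP => _; last by field; rewrite h2 h3 h4.
by field; rewrite h1 h2 h3 h4.
Qed.

Let G0 k : (k <= N)%N -> G 0 k = 1.
Proof. by move=> kN; rewrite /G divff// mulf_neq0 ?g_row0. Qed.

Let G_col0 j : (j <= N)%N -> G j 0 = 1.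
Proof.
by move=> kN; rewrite /G [g 0 0 * _]mulrC divff// mulf_neq0 ?g_row0 ?g_col0.
Qed.

Let lam01 : lam 1 != lam 0.
Proof.
rewrite -subr_eq0 qsinhB; try nonzero.
have -> : p ^+ 1 * x / Q - p ^+ 0 * x / Q = (p - 1) * (x / Q) by ring.
rewrite mulf_neq0//; last nonzero.
rewrite mulf_neq0 ?subr_eq0 ?(lt_eqF p_lt1)//; nonzero.
Qed.

(** If the difference were 0, the row of [K] at [k = 0] would give [K0 1 = 0], and then at [k = 1]
    it would give [lam 1 = lam 0]. *)
Let K00_neq : (0 < N)%N -> lam 0 - K0 0 != 0.
Proof.
move=> N0; apply/negP => /eqP e0.
have e1 : K0 1 * g 1 0 = (lam 0 - K0 0) * g 0 0.
  by rewrite mulrBl (K0_rec N0 (leq0n N)) [X in X - _]addrC addrK.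
have e2 : K0 1 * g 1 1 = (lam 1 - K0 0) * g 0 1.
  by rewrite mulrBl (K0_rec N0 N0) [X in X - _]addrC addrK.
move/eqP: e1; rewrite e0 mul0r mulf_eq0 (negbTE (g_col0 N0)) orbF => /eqP k1.
move/esym/eqP: e2; rewrite k1 mul0r mulf_eq0 (negbTE (g_row0 N0)) orbF.
move/eqP: e0; rewrite !subr_eq0 => /eqP <-.
by apply/negP; exact: lam01.
Qed.

(** [K (f 0)] involves only [f 0] and [f 1]; the unknown [K0 1] is eliminated by comparison with
    [k = 0]. *)
Let G1 k : (0 < N)%N -> (k <= N)%N ->
  (lam 0 - K0 0) * G 1 k = lam k - K0 0.
Proof.
move=> N0 kN.
have e1 : K0 1 * g 1 0 = (lam 0 - K0 0) * g 0 0.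
  by rewrite mulrBl (K0_rec N0 (leq0n N)) [X in X - _]addrC addrK.
have e2 : K0 1 * g 1 k = (lam k - K0 0) * g 0 k.
  by rewrite mulrBl (K0_rec N0 kN) [X in X - _]addrC addrK.
rewrite /G !mulrA -e1.
have -> : K0 1 * g 1 0 * g 1 k = (K0 1 * g 1 k) * g 1 0 by ring.
rewrite e2; have := g_row0 kN; have := g_col0 N0 => h1 h2.
by field; rewrite h1 h2.
Qed.

Let coefsE k : (k < N)%N ->
  bk k = - (Q / y) * qRacah_A a b c d p (p ^+ k)
  /\ dk k = - (Q / y) * qRacah_C a b c d p (p ^+ k).
Proof.
move=> kN; have N0 : (0 < N)%N by apply: leq_ltn_trans kN.
have kN' := ltnW kN.
(* First linear equation for [bk k] and [dk k]: the row [j = 0]. The second one, below, is the row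
   [j = 1] multiplied by [lam 0 - K0 0]. *)
have sumE : bk k + dk k = mu 0 - L k k.
  have := G_rec (leq0n N) kN; rewrite !G0 ?(leq_trans (leq_pred k))// => e.
  by rewrite !mulr1 in e; rewrite e; ring.
apply: (AW_coef_unique q_gt0 x_gt0 y_gt0 z_gt0 Q_gt0 (exprn_gt0 k p_gt0)).
- by rewrite lt_eqF// exprn_ilt1 ?ltW.
- by rewrite sumE L_diag.
rewrite -K0_diag.
have := G_rec N0 kN => e1.
have {}e1 : mu 1 * (lam k - K0 0)
    = dk k * ((lam 0 - K0 0) * G 1 k.-1) + L k k * (lam k - K0 0)
      + bk k * (lam k.+1 - K0 0).
  by rewrite -(G1 N0 kN') -(G1 N0 kN) mulrCA e1; ring.
have lamS : qsinh (q ^+ 2 * p ^+ k * x / Q) = lam k.+1.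
  by rewrite /lam [p ^+ k.+1]exprS.
have {}e1 : mu 1 * (lam k - K0 0)
    = dk k * (qsinh (p ^+ k / q ^+ 2 * x / Q) - K0 0) + L k k * (lam k - K0 0)
      + bk k * (lam k.+1 - K0 0).
  (* At [k = 0] the point [p ^+ k / q ^+ 2] leaves the grid, which is harmless as [dk 0 = 0]. *)
  rewrite e1; congr (_ + _ + _); case: k kN kN' {e1 sumE lamS} => [|k] kN kN'.
    by rewrite /dk ltnn !mul0r.
  rewrite G1 ?(ltnW kN')//= [p ^+ k.+1]exprS [p * _]mulrC mulfK// lt0r_neq0//.
have mu0E : qsinh (1 * y / Q) = bk k + dk k + L k k by rewrite sumE subrK.
by rewrite -/p lamS mu0E mulrBl -/(mu 1) -/(lam k) e1; ring.
Qed.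

Lemma scalar_overlap j k : (j <= N)%N -> (k <= N)%N ->
  g 0 0 * g j k / (g j 0 * g 0 k) = qRacah_fun a b c d p j (p ^+ k).
Proof.
move=> jN; rewrite -/(G j k).
have ltk : forall i, (i < N)%N -> 0 < 1 - p ^+ i.+1.
  by move=> i _; rewrite subr_gt0 exprn_ilt1 ?ltW.
(* [a], [a * b] and [b * d] are negative, so their factors in the denominators are positive. *)
have abE : a * b = - (x / (Q * q)) ^+ 2 by rewrite /a /b; field; nonzero.
have bdE : b * d = - (x * y / (z * Q * q)) by rewrite /b /d; field; nonzero.
(* As [c = p^-(N+1)], the factor [1 - c p^(l+1)] vanishes only at [l = N], just beyond the range. *)
have hc l : (l < N)%N -> 1 - c * p ^+ l.+1 != 0.
  move=> lN; rewrite subr_eq0; apply/eqP => /esym h.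
  have Qq0 : (Q * q) ^+ 2 != 0 by nonzero.
  have /expp_inj[lN'] : p ^+ l.+1 = p ^+ N.+1.
    rewrite -[LHS](mulVKf Qq0) -/c h mulr1.
    by rewrite -exprSr -exprM mulnC exprM.
  by rewrite lN' ltnn in lN.
have step i : (i < N)%N ->
    mu j * qRacah_fun a b c d p j (p ^+ i)
    = dk i * qRacah_fun a b c d p j (p ^+ i.-1)
      + L i i * qRacah_fun a b c d p j (p ^+ i)
      + bk i * qRacah_fun a b c d p j (p ^+ i.+1).
  move=> iN; have [bE dE] := coefsE iN.
  have pi := exprn_gt0 i p_gt0.
  have rec : qRacah_A a b c d p (p ^+ i)
      * (qRacah_fun a b c d p j (p * p ^+ i) - qRacah_fun a b c d p j (p ^+ i))
    + qRacah_C a b c d p (p ^+ i)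
      * (qRacah_fun a b c d p j (p ^+ i / p) - qRacah_fun a b c d p j (p ^+ i))
    = qRacah_eps c d p j * qRacah_fun a b c d p j (p ^+ i).
    apply: qRacah_fun_rec; rewrite ?abE; try nonzero.
    - by move=> m; nonzero.
    - move=> l lj; rewrite bdE; split; try nonzero.
      + by apply: hc; rewrite (leq_trans lj).
      + by rewrite lt0r_neq0 // ltk// (leq_trans lj).
  have mujE : mu j = mu 0 - (Q / y) * qRacah_eps c d p j.
    have := qRacah_eps_mu q_gt0 y_gt0 Q_gt0 j.
    by rewrite mulNr => <-; rewrite addrC subrK.
  have mu0E : mu 0 = bk i + dk i + L i i.
    have := G_rec (leq0n N) iN.
    by rewrite !G0 ?(leq_trans (leq_pred i)) ?(ltnW iN)// !mulr1 => ->; ring.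
  have dC : dk i * qRacah_fun a b c d p j (p ^+ i / p)
      = dk i * qRacah_fun a b c d p j (p ^+ i.-1).
    case: i {iN bE dE pi rec mu0E} => [|i]; first by rewrite /dk ltnn !mul0r.
    by rewrite [p ^+ i.+1]exprS [p * _]mulrC mulfK// lt0r_neq0.
  rewrite -dC mujE mulrBl -[Q / y * _ * _]mulrA -rec mu0E.
  by rewrite [p ^+ i.+1]exprS bE dE; ring.
(* A nonzero leading coefficient lets the recurrence determine the value at [k.+1] from those at [k]
   and [k.-1]. *)
have bk_neq0 i : (i < N)%N -> bk i != 0.
  move=> iN; have [-> _] := coefsE iN; have pi := exprn_gt0 i p_gt0.
  rewrite mulNr oppr_eq0 mulf_neq0//; first by nonzero.
  rewrite /qRacah_A abE bdE; apply: mulf_neq0; last first.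
    by rewrite invr_eq0 mulf_neq0//; nonzero.
  apply: mulf_neq0; last by rewrite -mulrA -exprS hc.
  by nonzero.
elim/ltn_ind: k => -[|k] IH kN; first by rewrite G_col0// expr0 qRacah_fun1.
have kS : (k.-1 < k.+1)%N by rewrite ltnS leq_pred.
have kN' : (k.-1 <= N)%N by rewrite (leq_trans (leq_pred k))// ltnW.
have := G_rec jN kN; rewrite (IH k (ltnSn k) (ltnW kN)) (IH _ kS kN').
by rewrite step// => /addrI /(mulfI (bk_neq0 _ kN)).
Qed.

End ScalarOverlap.

(** * Real powers of [q] and the eigenvalue grid *)

Section RealPowers.
Variables (R : realType) (q : R).
Hypothesis q_gt0 : 0 < q.

Lemma powRD_gt0 r s : q `^ (r + s) = q `^ r * q `^ s.
Proof. by rewrite powRD// lt0r_neq0 ?implybT. Qed.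

Lemma powRB_gt0 r s : q `^ (r - s) = q `^ r / q `^ s.
Proof. by rewrite powRB// lt0r_neq0 ?implybT. Qed.

Lemma powR_nat n : q `^ n%:R = q ^+ n.
Proof. by rewrite powR_mulrn// ltW. Qed.

Lemma powR_double r : q `^ (2 * r) = (q `^ r) ^+ 2.
Proof. by rewrite mulr_natl mulr2n powRD_gt0 expr2. Qed.

Lemma powR_1 : q `^ 1 = q.
Proof. by rewrite powRr1// ltW. Qed.

Lemma sinhqE u : sinhq q u = qsinh (q `^ u).
Proof. by rewrite /sinhq powRN. Qed.

Lemma sinhq_grid (k N : nat) al :
  sinhq q (2 * (k%:R - N%:R / 2) + al)
  = qsinh ((q ^+ 2) ^+ k * q `^ al / q ^+ N).
Proof.
have -> : 2 * (k%:R - N%:R / 2) + al = 2 * k%:R + al - N%:R by field.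
by rewrite sinhqE powRB_gt0 powRD_gt0 powR_double !powR_nat -!exprM mulnC.
Qed.

End RealPowers.

(** * Orthonormal eigenvectors and matrix elements *)

Section InnerProduct.
Variables (R : realType) (V : vectType R[i]) (dot : {dot V for Num.conj}).

Lemma dotZl a u v : dot (a *: u) v = a * dot u v.
Proof. by rewrite linearZl_LR. Qed.

Lemma dotDl u v w : dot (u + v) w = dot u w + dot v w.
Proof. by rewrite linearDl. Qed.

Lemma dotNl u v : dot (- u) v = - dot u v.
Proof. by rewrite linearNl. Qed.

Lemma dot_suml I (r : seq I) (P : pred I) (E : I -> V) v :
  dot (\sum_(i <- r | P i) E i) v = \sum_(i <- r | P i) dot (E i) v.
Proof. by rewrite linear_sumlz. Qed.

Lemma dotZr_real (r : R) u v : dot u (r%:C%C *: v) = r%:C%C * dot u v.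
Proof. by rewrite linearZr_LR /=; congr (_ * _); exact: conjc_real. Qed.

Lemma dotC u v : dot u v = Num.conj (dot v u).
Proof. by rewrite hermC expr0 mul1r. Qed.

Lemma orthonormal_expand n (e : 'I_n -> V) : \dim {:V} = n ->
  (forall i j, dot (e i) (e j) = (i == j)%:R) ->
  forall v, v = \sum_i dot v (e i) *: e i.
Proof.
move=> dimV orth v; pose X := [tuple e i | i < n].
have XE (i : 'I_n) : X`_i = e i by rewrite -tnth_nth tnth_mktuple.
have dotE (k : 'I_n -> R[i]) j : dot (\sum_i k i *: X`_i) (e j) = k j.
  rewrite linear_sumlz (bigD1 j)//= big1 ?addr0.
    by rewrite dotZl XE orth eqxx mulr1.
  by move=> i ij; rewrite dotZl XE orth (negbTE ij) mulr0.
have freeX : free X.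
  by apply/freeP => k k0 i; rewrite -(dotE k i) k0 linear0l.
have basisX : basis_of fullv X.
  by rewrite basisEfree freeX subvf dimV size_tuple leqnn.
have vE := coord_basis basisX (memvf v).
rewrite {1}vE; apply: eq_bigr => i _; rewrite XE; congr (_ *: _).
by rewrite {2}vE dotE.
Qed.

Lemma eigen_orthonormal n (T : 'End(V)) (ev : 'I_n -> R) (e : 'I_n -> V) :
  self_adjoint dot T -> injective ev ->
  (forall i, dot (e i) (e i) = 1) -> (forall i, T (e i) = (ev i)%:C%C *: e i) ->
  forall i j, dot (e i) (e j) = (i == j)%:R.
Proof.
move=> saT inj norm1 Te i j; have [->|ij] := eqVneq i j; first exact: norm1.
have := saT (e i) (e j); rewrite !Te dotZl dotZr_real => /eqP.
rewrite -subr_eq0 -mulrBl mulf_eq0 -rmorphB fmorph_eq0 subr_eq0.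
by case/orP=> [/eqP/inj/eqP|/eqP->//]; rewrite (negbTE ij).
Qed.

Local Notation "X ** Y" := (comp_lfun X Y) (at level 40, left associativity).

Lemma rscalE (c : R) (u : V) : rscal c u = c%:C%C *: u.
Proof. by rewrite /rscal scale_lfunE id_lfunE. Qed.

(** The relation is applied to an eigenvector [u] and paired with an eigenvector [v];
    self-adjointness moves [K] onto [v]. Since [D] and [E] are evaluated only at [u], structure
    parameters that are operators are covered as soon as they act on [u] by scalars. *)
Lemma AW_matrix_element (K L D E : 'End(V)) (c1 c2 sg : R[i]) (s2 : R)
    (kap kap' : R) (del eps : R[i]) u v :
  c2 *: (K ** L ** K) - K ** K ** L - L ** K ** K
    = sg *: (D ** K) - c1 ^+ 2 *: (rscal s2 ** L) + c1 *: E ->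
  self_adjoint dot K ->
  K u = kap%:C%C *: u -> K v = kap'%:C%C *: v ->
  D u = del *: u -> E u = eps *: u ->
  (c2 * kap%:C%C * kap'%:C%C - kap%:C%C ^+ 2 - kap'%:C%C ^+ 2
     + c1 ^+ 2 * s2%:C%C) * dot (L u) v
  = (sg * del * kap%:C%C + c1 * eps) * dot u v.
Proof.
move=> rel saK Ku Kv Du Eu.
have := congr1 (fun T : 'End(V) => dot (T u) v) rel.
rewrite /rscal.
rewrite !(add_lfunE, opp_lfunE, scale_lfunE, comp_lfunE, id_lfunE).
rewrite !Ku !linearZ /= !Du Eu.
rewrite !Ku !linearZ /=.
have KKv : K (K v) = kap'%:C%C *: (kap'%:C%C *: v).
  by rewrite Kv linearZ /= Kv.
rewrite !(dotDl, dotNl, dotZl) !saK KKv !Kv !dotZr_real.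
move=> e; apply/eqP; rewrite -subr_eq0; apply/eqP.
move/eqP: e; rewrite -subr_eq0 => /eqP <-; ring.
Qed.

End InnerProduct.

(** * Transport of q-Racah values from the reals to the complex numbers *)

Section Morphism.
Variables (F F' : fieldType) (h : {rmorphism F -> F'}).

Lemma rmorph_qpoch a p n : h (qpoch a p n) = qpoch (h a) (h p) n.
Proof.
rewrite rmorph_prod; apply: eq_bigr => i _.
by rewrite rmorphB rmorph1 rmorphM rmorphXn.
Qed.

Lemma rmorph_qRacah n j a b c d p :
  h (qRacah n j a b c d p) = qRacah n j (h a) (h b) (h c) (h d) (h p).
Proof.
rewrite rmorph_sum; apply: eq_bigr => i _.
by rewrite !(rmorphM, fmorphV, rmorph_qpoch, rmorphXn).
Qed.

Lemma rmorph_qsinh u : h (qsinh u) = qsinh (h u).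
Proof. by rewrite rmorphB fmorphV. Qed.

End Morphism.

(** * Overlaps of a self-adjoint pair of operators *)

Section RankOne.
Variables (R : realType) (q al0 al1 al2 : R) (N : nat).
Variables (W : vectType R[i]) (dot : {dot W for Num.conj}).
Variables (K L A0 A1 : 'End(W)) (e f : 'I_N.+1 -> W).

(** The families [e] and [f] may span a proper subspace of [W], such as [V1] tensored with a fixed
    vector; hence the mutual expansions are assumed instead of a basis property. *)
Lemma AW_overlap_qRacah :
  0 < q -> q < 1 ->
  AW_relations q K L A0 A1 (rscal (coshq q al2)) (rscal (coshq q (N%:R + 1)))
    (rscal (sinhq q 1 ^+ 2)) (rscal (sinhq q 1 ^+ 2)) ->
  self_adjoint dot K -> self_adjoint dot L ->
  (forall i k, dot (e i) (e k) = (i == k)%:R) ->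
  (forall i j, dot (f i) (f j) = (i == j)%:R) ->
  (forall j, f j = \sum_k dot (f j) (e k) *: e k) ->
  (forall k, e k = \sum_j dot (e k) (f j) *: f j) ->
  (forall k : 'I_N.+1,
     K (e k) = (sinhq q (2 * (k%:R - N%:R / 2) + al0))%:C%C *: e k) ->
  (forall j : 'I_N.+1,
     L (f j) = (sinhq q (2 * (j%:R - N%:R / 2) + al1))%:C%C *: f j) ->
  (forall k, A0 (e k) = (sinhq q al0)%:C%C *: e k) ->
  (forall k, A1 (e k) = (sinhq q al1)%:C%C *: e k) ->
  (forall j, dot (f j) (e ord0) != 0) -> (forall k, dot (f ord0) (e k) != 0) ->
  forall j k : 'I_N.+1,
  dot (f ord0) (e ord0) * dot (f j) (e k)
    / (dot (f j) (e ord0) * dot (f ord0) (e k))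
  = (qRacah k j (- q `^ (al0 + al1 + al2 - N%:R - 1))
       (q `^ (al0 - al1 - al2 - N%:R - 1)) (q `^ (- (2 * N%:R) - 2))
       (- q `^ (2 * al1)) (q ^+ 2))%:C%C.
Proof.
move=> q_gt0 q_lt1 [rel1 rel2] saK saL orth_e orth_f fe ef Ke Lf A0e A1e.
move=> col0 row0 j k.
(* Each [f i] lies in the span of [e], where [A0] and [A1] act by scalars. *)
have A0f i : A0 (f i) = (sinhq q al0)%:C%C *: f i.
  rewrite (fe i) linear_sum scaler_sumr; apply: eq_bigr => l _.
  by rewrite linearZ /= A0e scalerA mulrC -scalerA.
have A1f i : A1 (f i) = (sinhq q al1)%:C%C *: f i.
  rewrite (fe i) linear_sum scaler_sumr; apply: eq_bigr => l _.
  by rewrite linearZ /= A1e scalerA mulrC -scalerA.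
pose h := real_complex R.
have hgt0 r : 0 < r -> 0 < h r by move=> r0; rewrite ltcR.
have c2E : (coshq q 2)%:C%C = h q ^+ 2 + h q ^- 2.
  by rewrite /coshq powRN (powR_nat q_gt0 2) rmorphD fmorphV rmorphXn.
have c1E : (coshq q 1)%:C%C = h q + (h q)^-1.
  by rewrite /coshq powRN powR_1// rmorphD fmorphV.
have s1E : (sinhq q 1)%:C%C = h q - (h q)^-1.
  by rewrite /sinhq powRN powR_1// rmorphB fmorphV.
have a2E : (coshq q al2)%:C%C = h (q `^ al2) + (h (q `^ al2))^-1.
  by rewrite /coshq powRN rmorphD fmorphV.
have a3E : (coshq q (N%:R + 1))%:C%C = h q ^+ N * h q + (h q ^+ N * h q)^-1.
  rewrite /coshq powRN rmorphD fmorphV powRD_gt0// powR_1// powR_nat//.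
  by rewrite rmorphM rmorphXn.
have gridE (i : nat) al : (sinhq q (2 * (i%:R - N%:R / 2) + al))%:C%C
    = qsinh ((h q ^+ 2) ^+ i * h (q `^ al) / h q ^+ N).
  by rewrite sinhq_grid// rmorph_qsinh !rmorphM fmorphV !rmorphXn.
(* The eigenvalues are made opaque, keeping only their real form and their complex multiplicative
   form. *)
have [lam lamE] : {l : nat -> R | forall i, (l i)%:C%C
    = qsinh ((h q ^+ 2) ^+ i * h (q `^ al0) / h q ^+ N)
    /\ sinhq q (2 * (i%:R - N%:R / 2) + al0) = l i}.
  by exists (fun i => sinhq q (2 * (i%:R - N%:R / 2) + al0)).
have [mu muE] : {l : nat -> R | forall i, (l i)%:C%C
    = qsinh ((h q ^+ 2) ^+ i * h (q `^ al1) / h q ^+ N)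
    /\ sinhq q (2 * (i%:R - N%:R / 2) + al1) = l i}.
  by exists (fun i => sinhq q (2 * (i%:R - N%:R / 2) + al1)).
have {}Ke i : K (e i) = (lam i)%:C%C *: e i by rewrite Ke (lamE i).2.
have {}Lf i : L (f i) = (mu i)%:C%C *: f i by rewrite Lf (muE i).2.
have shE al : (sinhq q al)%:C%C = h (q `^ al) - (h (q `^ al))^-1.
  by rewrite /sinhq powRN rmorphB fmorphV.
have s2E : (sinhq q 1 ^+ 2)%:C%C = (h q - (h q)^-1) ^+ 2.
  by rewrite rmorphXn /= s1E.
have a0E := shE al0; have a1E := shE al1.
set a0 := (sinhq q al0)%:C%C in A0e A0f a0E.
set a1 := (sinhq q al1)%:C%C in A1e A1f a1E.
set a2 := (coshq q al2)%:C%C in a2E; set a3 := (coshq q (N%:R + 1))%:C%C in a3E.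
have DE u : A0 u = a0 *: u -> A1 u = a1 *: u ->
    ((A0 \o A1) - (rscal (coshq q al2) \o rscal (coshq q (N%:R + 1))))%VF u
    = (a0 * a1 - a2 * a3) *: u.
  move=> h0 h1; rewrite add_lfunE opp_lfunE !comp_lfunE !rscalE.
  by rewrite h1 linearZ /= h0 !scalerA -scalerBl [a1 * a0]mulrC.
have E1 u : A0 u = a0 *: u -> A1 u = a1 *: u ->
    ((A1 \o rscal (coshq q (N%:R + 1)) \o rscal (sinhq q 1 ^+ 2))
       + (sinhq q 1)%:C%C ^+ 2 *: (A0 \o rscal (coshq q al2)))%VF u
    = (sinhq q 1)%:C%C ^+ 2 * (a1 * a3 + a0 * a2) *: u.
  move=> h0 h1; rewrite add_lfunE scale_lfunE !comp_lfunE !rscalE.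
  rewrite !linearZ /= h0 h1 !scalerA -scalerDl; congr (_ *: _).
  by rewrite rmorphXn; ring.
have E2 u : A0 u = a0 *: u -> A1 u = a1 *: u ->
    ((A0 \o rscal (coshq q (N%:R + 1)) \o rscal (sinhq q 1 ^+ 2))
       + (sinhq q 1)%:C%C ^+ 2 *: (A1 \o rscal (coshq q al2)))%VF u
    = (sinhq q 1)%:C%C ^+ 2 * (a0 * a3 + a1 * a2) *: u.
  move=> h0 h1; rewrite add_lfunE scale_lfunE !comp_lfunE !rscalE.
  rewrite !linearZ /= h0 h1 !scalerA -scalerDl; congr (_ *: _).
  by rewrite rmorphXn; ring.
pose g (j k : nat) := dot (f (inord j)) (e (inord k)).
have := @scalar_overlap R[i] (h q) (h (q `^ al0)) (h (q `^ al1)) (h (q `^ al2))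
 N (hgt0 _ q_gt0) _ (hgt0 _ (powR_gt0 _ q_gt0)) (hgt0 _ (powR_gt0 _ q_gt0))
 (hgt0 _ (powR_gt0 _ q_gt0)) g (fun k i => dot (L (e (inord i))) (e (inord k)))
 (fun i => dot (K (f ord0)) (f (inord i))).
have inord0 : inord 0 = ord0 :> 'I_N.+1 by apply: val_inj; rewrite /= inordK.
have dotfe u i : dot (f i) u = \sum_l dot (f i) (e l) * dot (e l) u.
  by rewrite {1}(fe i) dot_suml; apply: eq_bigr => l _; rewrite dotZl.
have dotef u i : dot u (e i) = \sum_l dot u (f l) * dot (f l) (e i).
  rewrite dotC {1}(ef i) dot_suml rmorph_sum; apply: eq_bigr => l _.
  by rewrite dotZl (dotC dot u (f l)) (dotC dot (f l) (e i)) rmorphM mulrC.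
move=> /(_ _ _ _ _ _ _ _ j k); rewrite /g inord0 !inord_val => ->.
- rewrite [RHS]rmorph_qRacah qRacah_funE; last first.
    by rewrite fmorph_eq0 expf_neq0// lt0r_neq0.
  rewrite !rmorphN !rmorphXn.
  have aE : q `^ (al0 + al1 + al2 - N%:R - 1)
      = q `^ al0 * q `^ al1 * q `^ al2 / (q ^+ N * q).
    by rewrite !powRD_gt0// !powRN powR_1// powR_nat// invfM !mulrA.
  have bE : q `^ (al0 - al1 - al2 - N%:R - 1)
      = q `^ al0 / (q `^ al1 * q `^ al2 * q ^+ N * q).
    by rewrite !powRD_gt0// !powRN powR_1// powR_nat// !invfM !mulrA.
  have cE : q `^ (- (2 * N%:R) - 2) = (q ^+ N * q) ^- 2.
    rewrite powRB_gt0// powRN powR_double// powR_nat// (powR_nat q_gt0 2).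
    by rewrite -invfM -exprMn.
  rewrite aE bE cE powR_double//.
  by rewrite !(rmorphM, fmorphV, rmorphXn).
- by rewrite ltcR.
- move=> j' k' jN kN.
  have := dotfe (L (e (inord k'))) (inord j').
  rewrite -saL Lf dotZl (muE _).1 inordK//.
  by move=> ->; apply: eq_bigr => i _; rewrite inord_val mulrC saL.
- move=> k' i kN iN.
  have := AW_matrix_element rel1 saK (Ke (inord i)) (Ke (inord k'))
    (DE _ (A0e _) (A1e _)) (E1 _ (A0e _) (A1e _)).
  rewrite orth_e !(fun i => (lamE i).1).
  rewrite !inordK// c2E c1E s2E s1E a0E a1E a2E a3E.
  have -> : (inord i == inord k' :> 'I_N.+1) = (k' == i).
    by rewrite -val_eqE /= !inordK// eq_sym.
  have [<-|_] := eqVneq k' i; last first.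
    by rewrite mulr0 mul0r => h0; rewrite -[RHS]h0; congr (_ * _); ring.
  by rewrite mulr1 [true%:R * _]mul1r => h0; rewrite h0; ring.
- move=> k' kN.
  have := dotef (K (f ord0)) (inord k').
  rewrite saK Ke dotZr_real (lamE _).1 inordK// => ->.
  by apply: eq_bigr => i _; rewrite inord_val.
- move=> i iN.
  have := AW_matrix_element rel2 saL (Lf ord0) (Lf (inord i))
    (DE _ (A0f _) (A1f _)) (E2 _ (A0f _) (A1f _)).
  rewrite orth_f !(fun i => (muE i).1) inordK// -[nat_of_ord ord0]/0%N.
  rewrite c2E c1E s2E s1E a0E a1E a2E a3E.
  have -> : (ord0 == inord i :> 'I_N.+1) = (0%N == i).
    by rewrite -val_eqE /= !inordK.
  have [<-|_] := eqVneq 0%N i; last first.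
    by rewrite mulr0 mul0r => h0; rewrite -[RHS]h0; congr (_ * _); ring.
  by rewrite mulr1 [true%:R * _]mul1r => h0; rewrite h0; ring.
- by move=> i _; exact: row0.
- by move=> i _; exact: col0.
- by rewrite -ltnS.
- by rewrite -ltnS.
Qed.

End RankOne.

(** * Simplicity of the spectrum and the q-Racah nodes *)

Section Grid.
Variables (R : realType) (q : R).
Hypotheses (q_gt0 : 0 < q) (q_lt1 : q < 1).

Lemma sinhq_grid_inj (N : nat) al :
  injective (fun k : 'I_N.+1 => sinhq q (2 * (k%:R - N%:R / 2) + al)).
Proof.
move=> k i /eqP; rewrite !sinhq_grid// -subr_eq0.
have qp n : 0 < (q ^+ 2) ^+ n * q `^ al / q ^+ N.
  by rewrite !mulr_gt0 ?invr_gt0 ?exprn_gt0 ?powR_gt0.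
rewrite qsinhB ?lt0r_neq0// mulf_eq0 orbC gt_eqF /=; last first.
  by rewrite addr_gt0 ?ltr01// invr_gt0 mulr_gt0 ?qp.
rewrite subr_eq0 => /eqP /(mulIf (invr_neq0 (lt0r_neq0 (exprn_gt0 N q_gt0)))).
move=> /(mulIf (lt0r_neq0 (powR_gt0 al q_gt0))).
have q2_lt1 : q ^+ 2 < 1 by rewrite exprn_ilt1 ?ltW.
move=> /eqP; rewrite eq_le !ler_iXn2l ?exprn_gt0//.
by rewrite -eqn_leq => /eqP/esym/val_inj.
Qed.

Lemma qRacah_node_powR (j N : nat) al :
  qRacah_node j (q `^ (- (2 * N%:R) - 2)) (- q `^ al) (q ^+ 2)
  = q `^ (- (2 * j%:R)) - q `^ (al - 2 * N%:R + 2 * j%:R).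
Proof.
have pE n : (q ^+ 2) ^+ n = q `^ (2 * n%:R).
  by rewrite powR_double// powR_nat// -!exprM mulnC.
rewrite /qRacah_node !pE powRN mulrN mulNr -!powRD_gt0//.
by congr (_ - _ `^ _); rewrite -[j.+1]addn1 natrD; ring.
Qed.

End Grid.

(** * Factorization of the overlap on the tensor product *)

Theorem theorem4p5
  (R : realType) (q alpha0 alpha1 alpha2 : R) (N1 N2 : nat)
  (hq0 : 0 < q) (hq1 : q < 1)
  (lambda := fun x : R => sinhq q (2 * x + alpha0))
  (mu := fun x : R => sinhq q (2 * x + alpha1))
  (A0 := sinhq q alpha0) (A1 := sinhq q alpha1) (A2 := coshq q alpha2)
  (AN1 := coshq q (N1%:R + 1)) (AN2 := coshq q (N2%:R + 1))
  (sigmaK := sinhq q 1 ^+ 2) (sigmaL := sinhq q 1 ^+ 2)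
  (* the spaces V1, V2 and W = V1 (x) V2 *)
  (V1 V2 W : vectType R[i])
  (dimV1 : \dim {:V1} = N1.+1) (dimV2 : \dim {:V2} = N2.+1)
  (dot1 : {dot V1 for Num.conj}) (dot2 : {dot V2 for Num.conj})
  (dot12 : {dot W for Num.conj})
  (tens : {bilinear V1 -> V2 -> W})
  (htens : is_tensor_product tens)
  (hdot12 : forall v v' w w',
     dot12 (tens v w) (tens v' w') = dot1 v v' * dot2 w w')
  (* the representations of AW_1(A_{N_i}) on V_i *)
  (K1V1 L1V1 : 'End(V1)) (K1V2 L1V2 : 'End(V2))
  (hV1 : AW1_rep q A0 A1 A2 AN1 sigmaK sigmaL K1V1 L1V1)
  (hV2 : AW1_rep q A0 A1 A2 AN2 sigmaK sigmaL K1V2 L1V2)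
  (hK1V1 : diagonalizable_simple K1V1
     (fun k : 'I_N1.+1 => lambda (k%:R - N1%:R / 2)))
  (hL1V1 : diagonalizable_simple L1V1
     (fun j : 'I_N1.+1 => mu (j%:R - N1%:R / 2)))
  (hK1V2 : diagonalizable_simple K1V2
     (fun k : 'I_N2.+1 => lambda (k%:R - N2%:R / 2)))
  (hL1V2 : diagonalizable_simple L1V2
     (fun j : 'I_N2.+1 => mu (j%:R - N2%:R / 2)))
  (* the representation of AW_2 on V1 (x) V2 *)
  (K1l L1l K1r L1r K2 L2 M2 : 'End(W))
  (hW : AW2_rep q A0 A1 A2 AN1 AN2 sigmaK sigmaL K1l L1l K1r L1r K2 L2 M2)
  (hK1l : is_tensor_operator tens K1V1 \1%VF K1l)
  (hL1l : is_tensor_operator tens L1V1 \1%VF L1l)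
  (hK1r : is_tensor_operator tens \1%VF K1V2 K1r)
  (hL1r : is_tensor_operator tens \1%VF L1V2 L1r)
  (hself : [/\ self_adjoint dot12 K1r, self_adjoint dot12 L1l,
               self_adjoint dot12 K2, self_adjoint dot12 L2
             & self_adjoint dot12 M2])
  (* the eigenvectors, indexed by k2, (k2, k1), j1, (j1, j2) *)
  (n2 := fun k2 : 'I_N2.+1 => k2%:R - N2%:R / 2 : R)
  (n1 := fun (k2 : 'I_N2.+1) (k1 : 'I_N1.+1) => k1%:R + n2 k2 - N1%:R / 2 : R)
  (m1 := fun j1 : 'I_N1.+1 => j1%:R - N1%:R / 2 : R)
  (m2 := fun (j1 : 'I_N1.+1) (j2 : 'I_N2.+1) => j2%:R + m1 j1 - N2%:R / 2 : R)
  (psi2 : 'I_N2.+1 -> V2) (psi1 : 'I_N2.+1 -> 'I_N1.+1 -> V1)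
  (phi1 : 'I_N1.+1 -> V1) (phi2 : 'I_N1.+1 -> 'I_N2.+1 -> V2)
  (hpsi2 : forall k2, dot2 (psi2 k2) (psi2 k2) = 1
     /\ K1V2 (psi2 k2) = ((lambda (n2 k2))%:C)%C *: psi2 k2)
  (hphi1 : forall j1, dot1 (phi1 j1) (phi1 j1) = 1
     /\ L1V1 (phi1 j1) = ((mu (m1 j1))%:C)%C *: phi1 j1)
  (hpsi1_basis : forall k2, orthonormal_basis dot1 (psi1 k2))
  (hpsi1 : forall k2 k1, K2 (tens (psi1 k2 k1) (psi2 k2))
     = ((lambda (n1 k2 k1))%:C)%C *: tens (psi1 k2 k1) (psi2 k2))
  (hphi2_basis : forall j1, orthonormal_basis dot2 (phi2 j1))
  (hphi2 : forall j1 j2, L2 (tens (phi1 j1) (phi2 j1 j2))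
     = ((mu (m2 j1 j2))%:C)%C *: tens (phi1 j1) (phi2 j1 j2))
  (* the inner products in the denominator of C do not vanish *)
  (hne1 : forall j1 k2, dot1 (phi1 j1) (psi1 k2 ord0) != 0)
  (hne2 : forall j1 j2, dot2 (phi2 j1 j2) (psi2 ord0) != 0)
  (hne3 : forall k2 k1, dot1 (phi1 ord0) (psi1 k2 k1) != 0)
  (hne4 : forall j1 k2, dot2 (phi2 j1 ord0) (psi2 k2) != 0) :
  forall (k1 j1 : 'I_N1.+1) (k2 j2 : 'I_N2.+1),
  let a1 := - q `^ (alpha0 + 2 * k2%:R - N2%:R + alpha1 + alpha2 - N1%:R - 1) in
  let b1 := q `^ (alpha0 + 2 * k2%:R - N2%:R - alpha1 - alpha2 - N1%:R - 1) in
  let c1 := q `^ (- (2 * N1%:R) - 2) in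
  let d1 := - q `^ (2 * alpha1) in
  let a2 := - q `^ (alpha0 + alpha1 + 2 * j1%:R - N1%:R - alpha2 - N2%:R - 1) in
  let b2 := q `^ (alpha0 - alpha1 - 2 * j1%:R + N1%:R + alpha2 - N2%:R - 1) in
  let c2 := q `^ (- (2 * N2%:R) - 2) in
  let d2 := - q `^ (2 * alpha1 + 4 * j1%:R - 2 * N1%:R) in
  [/\ qRacah_node j1 c1 d1 (q ^+ 2)
        = q `^ (- (2 * j1%:R)) - q `^ (2 * alpha1 - 2 * N1%:R + 2 * j1%:R),
      qRacah_node j2 c2 d2 (q ^+ 2)
        = q `^ (- (2 * j2%:R))
          - q `^ (2 * alpha1 - 2 * N1%:R - 2 * N2%:R + 4 * j1%:R + 2 * j2%:R)
    & overlapP dot1 dot2 dot12 tens psi2 psi1 phi1 phi2 k1 j1 k2 j2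
        = ((qRacah k1 j1 a1 b1 c1 d1 (q ^+ 2)
            * qRacah k2 j2 a2 b2 c2 d2 (q ^+ 2))%:C)%C].
Proof.
move=> k1 j1 k2 j2 a1 b1 c1 d1 a2 b2 c2 d2.
have [saK1r saL1l saK2 saL2 saM2] := hself.
have tZl a v w : tens (a *: v) w = a *: tens v w by rewrite linearZl_LR.
have tZr a v w : tens v (a *: w) = a *: tens v w by rewrite linearZr_LR.
have tsuml n (F : 'I_n -> V1) w : tens (\sum_i F i) w = \sum_i tens (F i) w.
  by rewrite linear_sumlz.
have tsumr n (F : 'I_n -> V2) v : tens v (\sum_i F i) = \sum_i tens v (F i).
  by rewrite linear_sumr.
(* Self-adjointness descends to a tensor factor by pairing with a fixed unit vector in the other
   one. *)
have saL1 : self_adjoint dot1 L1V1.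
  move=> u v; have := saL1l (tens u (psi2 ord0)) (tens v (psi2 ord0)).
  by rewrite !hL1l !hdot12 id_lfunE (hpsi2 ord0).1 !mulr1.
have saK1 : self_adjoint dot2 K1V2.
  move=> u v; have := saK1r (tens (phi1 ord0) u) (tens (phi1 ord0) v).
  by rewrite !hK1r !hdot12 id_lfunE (hphi1 ord0).1 !mul1r.
have orth_phi1 : forall i j, dot1 (phi1 i) (phi1 j) = (i == j)%:R.
  apply: (eigen_orthonormal saL1 (@sinhq_grid_inj _ _ hq0 hq1 N1 alpha1)).
    by move=> i; exact: (hphi1 i).1.
  by move=> i; exact: (hphi1 i).2.
have orth_psi2 : forall i j, dot2 (psi2 i) (psi2 j) = (i == j)%:R.
  apply: (eigen_orthonormal saK1 (@sinhq_grid_inj _ _ hq0 hq1 N2 alpha0)).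
    by move=> i; exact: (hpsi2 i).1.
  by move=> i; exact: (hpsi2 i).2.
split.
- by rewrite /c1 /d1 qRacah_node_powR.
- by rewrite /c2 /d2 qRacah_node_powR//; congr (_ - _ `^ _); ring.
(* On [V1] tensored with [psi2 k2], the parameter [K1r] of the pair [K2], [L1l] acts as the scalar
   [lambda (n2 k2)], so [alpha0] becomes [2 * n2 k2 + alpha0]. *)
have part1 : dot1 (phi1 ord0) (psi1 k2 ord0) * dot1 (phi1 j1) (psi1 k2 k1)
    / (dot1 (phi1 j1) (psi1 k2 ord0) * dot1 (phi1 ord0) (psi1 k2 k1))
    = (qRacah k1 j1 a1 b1 c1 d1 (q ^+ 2))%:C%C.
  have a1E : a1 = - q `^ (2 * n2 k2 + alpha0 + alpha1 + alpha2 - N1%:R - 1).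
    by rewrite /a1 /n2; congr (- (q `^ _)); field.
  have b1E : b1 = q `^ (2 * n2 k2 + alpha0 - alpha1 - alpha2 - N1%:R - 1).
    by rewrite /b1 /n2; congr (q `^ _); field.
  pose e k := tens (psi1 k2 k) (psi2 k2).
  pose f j := tens (phi1 j) (psi2 k2).
  have dotE u v : dot12 (tens u (psi2 k2)) (tens v (psi2 k2)) = dot1 u v.
    by rewrite hdot12 (hpsi2 k2).1 mulr1.
  have := @AW_overlap_qRacah R q (2 * n2 k2 + alpha0) alpha1 alpha2 N1 W dot12
    K2 L1l K1r (rscal A1) e f hq0 hq1 (AW2_K2L1 hW).2 saK2 saL1l.
  move=> /(_ _ _ _ _ _ _ _ _ _ _ j1 k1); rewrite /e /f !dotE => -> //.
  - by rewrite a1E b1E.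
  - by move=> i k; rewrite dotE (hpsi1_basis k2).1.
  - by move=> i j; rewrite dotE.
  - move=> j; rewrite {1}(orthonormal_expand dimV1 (hpsi1_basis k2).1 (phi1 j)).
    by rewrite tsuml; apply: eq_bigr => k _; rewrite tZl dotE.
  - move=> k; rewrite {1}(orthonormal_expand dimV1 orth_phi1 (psi1 k2 k)).
    by rewrite tsuml; apply: eq_bigr => j _; rewrite tZl dotE.
  - move=> k; rewrite hpsi1 /lambda /n1; congr ((sinhq _ _)%:C%C *: _); ring.
  - by move=> j; rewrite hL1l (hphi1 j).2 id_lfunE tZl.
  - by move=> k; rewrite hK1r (hpsi2 k2).2 id_lfunE tZr.
  - by move=> k; exact: rscalE.
  - by move=> j; rewrite dotE.
  - by move=> k; rewrite dotE.
(* On [phi1 j1] tensored with [V2], the parameter [L1l] of the pair [K1r], [L2] acts as the scalar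
   [mu (m1 j1)], so [alpha1] becomes [2 * m1 j1 + alpha1]. *)
have part2 : dot2 (phi2 j1 ord0) (psi2 ord0) * dot2 (phi2 j1 j2) (psi2 k2)
    / (dot2 (phi2 j1 j2) (psi2 ord0) * dot2 (phi2 j1 ord0) (psi2 k2))
    = (qRacah k2 j2 a2 b2 c2 d2 (q ^+ 2))%:C%C.
  have a2E : a2 = - q `^ (alpha0 + (2 * m1 j1 + alpha1) + - alpha2 - N2%:R - 1).
    by rewrite /a2 /m1; congr (- (q `^ _)); field.
  have b2E : b2 = q `^ (alpha0 - (2 * m1 j1 + alpha1) - - alpha2 - N2%:R - 1).
    by rewrite /b2 /m1; congr (q `^ _); field.
  have d2E : d2 = - q `^ (2 * (2 * m1 j1 + alpha1)).
    by rewrite /d2 /m1; congr (- (q `^ _)); field.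
  pose e k := tens (phi1 j1) (psi2 k).
  pose f j := tens (phi1 j1) (phi2 j1 j).
  have dotE u v : dot12 (tens (phi1 j1) u) (tens (phi1 j1) v) = dot2 u v.
    by rewrite hdot12 (hphi1 j1).1 mul1r.
  have rel := (AW2_K1L2 hW).2.
  (* [coshq] is even, so the sign of [alpha2] may be chosen freely; the minus sign yields the stated
     [a2] and [b2]. *)
  have A2E : A2 = coshq q (- alpha2) by rewrite /A2 /coshq opprK addrC.
  rewrite A2E in rel.
  have := @AW_overlap_qRacah R q alpha0 (2 * m1 j1 + alpha1) (- alpha2) N2 W
    dot12 K1r L2 (rscal A0) L1l e f hq0 hq1 rel saK1r saL2.
  move=> /(_ _ _ _ _ _ _ _ _ _ _ j2 k2); rewrite /e /f !dotE => -> //.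
  - by rewrite a2E b2E d2E.
  - by move=> i k; rewrite dotE.
  - by move=> i j; rewrite dotE (hphi2_basis j1).1.
  - move=> j; rewrite {1}(orthonormal_expand dimV2 orth_psi2 (phi2 j1 j)).
    by rewrite tsumr; apply: eq_bigr => k _; rewrite tZr dotE.
  - move=> k; rewrite {1}(orthonormal_expand dimV2 (hphi2_basis j1).1 (psi2 k)).
    by rewrite tsumr; apply: eq_bigr => j _; rewrite tZr dotE.
  - by move=> k; rewrite hK1r (hpsi2 k).2 id_lfunE tZr.
  - move=> j; rewrite hphi2 /mu /m2; congr ((sinhq _ _)%:C%C *: _); ring.
  - by move=> k; exact: rscalE.
  - by move=> k; rewrite hL1l (hphi1 j1).2 id_lfunE tZl.
  - by move=> j; rewrite dotE.
  - by move=> k; rewrite dotE.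
rewrite rmorphM /= -part1 -part2 /overlapP /overlap_const hdot12.
by field; rewrite hne1 hne2 hne3 hne4.
Qed.
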